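(* Let $k\ge 2$, $\ell\ge 1$, $r\ge 2$ be integers and $0<\varepsilon<1/(k-1)$. There exists $n_0$ such that if $H$ is a linear $r$-uniform hypergraph on $n\ge n_0$ vertices with \[ q(H)\ge \frac{2n}{r-1}\left(1-\frac1k+\varepsilon\right), \] then $H$ contains an $r$-expansion of $K_{k+1}[\ell]$.
   Context: An $r$-uniform hypergraph is linear if any two distinct edges share at most one vertex; $d_H(v)$ is the number of edges containing $v$. Its signless Laplacian spectral radius is $q(H)=\max_{\|\mathbf{x}\|_r=1}\big(\sum_{v}d_H(v)x_v^r + r\sum_{e\in E(H)}\prod_{v\in e}x_v\big)$ with $\|\mathbf{x}\|_r=(\sum_v|x_v|^r)^{1/r}$. For a graph $F$, the $r$-expansion $F^r$ is the $r$-uniform hypergraph obtained from $F$ by enlarging each edge with $r-2$ new vertices, disjoint from $V(F)$, with distinct edges enlarged by distinct new vertices. $K_{k+1}[\ell]$ is the complete $(k+1)$-partite graph with all parts of size $\ell$. ''$H$ contains $F^r$'' means $H$ has a sub-hypergraph isomorphic to $F^r$. *)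

(* Defs.v *)
From HB Require Import structures.
From mathcomp Require Import all_boot all_order all_algebra.
From mathcomp Require Import classical_sets reals.
Set Implicit Arguments. Unset Strict Implicit. Unset Printing Implicit Defensive.
Import Order.TTheory GRing.Theory Num.Theory.

Definition uniform (n r : nat) (EH : {set {set 'I_n}}) : Prop :=
  forall e, e \in EH -> #|e| = r.

Definition linear_hg (n : nat) (EH : {set {set 'I_n}}) : Prop :=
  forall e1 e2, e1 \in EH -> e2 \in EH -> e1 != e2 -> (#|e1 :&: e2| <= 1)%N.

Definition hdeg (n : nat) (EH : {set {set 'I_n}}) (v : 'I_n) : nat :=
  #|[set e in EH | v \in e]|.

Local Open Scope ring_scope.

Definition qform (R : realType) (n r : nat) (EH : {set {set 'I_n}})
  (x : 'I_n -> R) : R :=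
  \sum_(v : 'I_n) (hdeg EH v)%:R * x v ^+ r
  + r%:R * \sum_(e in EH) \prod_(v in e) x v.

(* q(H) = max over ||x||_r = 1 (i.e. sum_v |x_v|^r = 1) of qform; the max
   is attained (continuous function on a compact set), so it equals the sup. *)
Definition qH (R : realType) (n r : nat) (EH : {set {set 'I_n}}) : R :=
  sup [set qform r EH x | x in [set x : 'I_n -> R |
                                  \sum_(v : 'I_n) `|x v| ^+ r = 1]]%classic.

(* r-expansion F^r of a graph F = (V, EF) (EF a set of 2-element sets):
   vertex type V + ({set V} * 'I_(r-2)); the new vertices of edge e are
   inr (e, i), i < r-2. *)
Definition exp_vertices (V : finType) (EF : {set {set V}}) (r : nat)
  : {set (V + ({set V} * 'I_(r-2)))%type} :=
  [set inl v | v : V] :|: [set inr (e, i) | e in EF, i in 'I_(r-2)].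

Definition exp_edge (V : finType) (r : nat) (e : {set V})
  : {set (V + ({set V} * 'I_(r-2)))%type} :=
  [set inl v | v in e] :|: [set inr (e, i) | i in 'I_(r-2)].

Definition exp_edges (V : finType) (EF : {set {set V}}) (r : nat)
  : {set {set (V + ({set V} * 'I_(r-2)))%type}} :=
  [set exp_edge r e | e in EF].

Definition contains_expansion (n : nat) (EH : {set {set 'I_n}})
  (V : finType) (EF : {set {set V}}) (r : nat) : Prop :=
  exists f : (V + ({set V} * 'I_(r-2)))%type -> 'I_n,
    {in exp_vertices EF r &, injective f} /\
    forall e, e \in exp_edges EF r -> f @: e \in EH.

Definition complete_multipartite (p l : nat) : {set {set ('I_p * 'I_l)%type}} :=
  [set [set u; v] | u in [set: ('I_p * 'I_l)%type],
                     v in [set w : ('I_p * 'I_l)%type | w.1 != u.1]].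

(* Main.v *)
Require Import Defs.
From HB Require Import structures.
From mathcomp Require Import all_boot all_order all_algebra.
From mathcomp Require Import classical_sets reals.
From mathcomp Require Import ring lra zify.
(* Imported again so that [set0], [subsetP], ... refer to finite sets. *)
From mathcomp Require Import fintype finset.
Set Implicit Arguments. Unset Strict Implicit. Unset Printing Implicit Defensive.
Import Order.TTheory GRing.Theory Num.Theory.

(** AM-GM over the pairs of vertices of an edge gives [q(H) <= q(G) / (r - 1)], where [G]
    is the shadow graph of [H]; so some unit vector [y] has
    [sum_(uv in E(G)) (y_u + y_v)^2 >= 2 n (1 - 1/k + eps / 2)].

    For a graph without [k+1]-cliques on [m] vertices, [q <= 2 m (1 - 1/k)]: as in the
    Motzkin--Straus argument, with vertex weights [z], the form
    [sum_(uv in E) z_u z_v (y_u + y_v)^2 - 2 (1 - 1/k) (sum z) (sum z y^2)] is affine along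
    any move of weight between two non-adjacent vertices, so one may assume that [z] is
    supported on a clique, where the inequality follows from Cauchy--Schwarz and [k >= 2].

    Entries of [y] much larger than [n^(-1/2)] can be discarded, again since [k >= 2]. The
    average over all samples of [m] vertices of [G] then shows that a positive proportion
    of the samples violates the previous bound, hence contains a [k+1]-clique. By
    Erdős's theorem on dense [m]-partite hypergraphs, [G] contains [K_{k+1}[L]] for any
    given [L] once [n] is large. As [H] is linear, the vertices of the core of an
    expansion are then chosen greedily, each avoiding a set of bounded size. *)

Lemma leq_card_bigcup (I T : finType) (A : {pred I}) (F : I -> {set T}) m :
  (forall i, #|F i| <= m) -> #|\bigcup_(i in A) F i| <= #|A| * m.
Proof.
move=> leF; rewrite -sum_nat_const.
apply: (big_ind2 (fun (X : {set T}) x => #|X| <= x)) => //.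
  by rewrite cards0.
move=> X1 x1 X2 x2 le1 le2; apply: leq_trans (leq_add le1 le2).
by rewrite cardsU leq_subr.
Qed.

(** * Boxes in dense sets of tuples *)

Section DenseBox.
Variable V : finType.

Definition fcons m (v : V) (t : {ffun 'I_m -> V}) : {ffun 'I_m.+1 -> V} :=
  [ffun i => oapp t v (unlift ord0 i)].

Lemma fcons0 m v (t : {ffun 'I_m -> V}) : fcons v t ord0 = v.
Proof. by rewrite ffunE unlift_none. Qed.

Lemma fconsS m v (t : {ffun 'I_m -> V}) i : fcons v t (lift ord0 i) = t i.
Proof. by rewrite ffunE liftK. Qed.

Lemma fcons_eta m (f : {ffun 'I_m.+1 -> V}) :
  fcons (f ord0) [ffun i => f (lift ord0 i)] = f.
Proof.
apply/ffunP => i; case: (unliftP ord0 i) => [j|] ->; last by rewrite fcons0.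
by rewrite fconsS ffunE.
Qed.

Lemma card_fcons m (D : {set {ffun 'I_m.+1 -> V}}) :
  #|D| = \sum_t #|[set v | fcons v t \in D]|.
Proof.
under eq_bigr do rewrite -sum1dep_card.
rewrite pair_big_dep /= -sum1_card.
rewrite (reindex (fun p : {ffun 'I_m -> V} * V => fcons p.2 p.1)) //=.
exists (fun f => ([ffun i => f (lift ord0 i)], f ord0)) => [[t v] _|f _] /=.
  by rewrite fcons0; congr pair; apply/ffunP => i; rewrite ffunE fconsS.
exact: fcons_eta.
Qed.

Lemma leq_exp_ffact n L : (n - L) ^ L <= n ^_ L.
Proof.
rewrite ffact_prod -[L in _ ^ L]card_ord -prod_nat_const.
by apply: leq_prod => i _; apply: leq_sub2l; apply: ltnW.
Qed.

(** Double counting. At least [#|V| ^ m / (2 * d)] tails [t] have at least [#|V| / (2 * d)] heads in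
    [D], and each of these admits at least [(#|V| / (4 * d)) ^ L] injective [L]-tuples of heads.
    Averaging over the at most [#|V| ^ L] injections gives one with many common tails. *)
Lemma dense_box_step m L d (D : {set {ffun 'I_m.+1 -> V}}) :
  0 < #|V| -> 4 * d * L <= #|V| -> #|V| ^ m.+1 <= d * #|D| ->
  exists2 g : {ffun 'I_L -> V}, injective g &
    #|V| ^ m <= 2 * d * (4 * d) ^ L *
      #|[set t | [forall a, fcons (g a) t \in D]]|.
Proof.
set n := #|V| => n0 nL dense.
pose N t := [set v | fcons v t \in D].
pose T := [set t | n <= 2 * d * #|N t|].
have denseT : n ^ m <= 2 * d * #|T|.
  rewrite -(leq_pmul2l n0) -expnS -(leq_add2r (n ^ m.+1)) addnn -mul2n.
  apply: leq_trans (_ : 2 * (d * #|D|) <= _); first by rewrite leq_mul2l.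
  rewrite mulnA card_fcons big_distrr /= (bigID (mem T)) /=.
  apply: leq_add.
    rewrite (_ : n * _ = #|T| * (2 * d * n)); last by rewrite mulnCA [RHS]mulnCA [n * _]mulnC.
    rewrite -sum_nat_const; apply: leq_sum => t _.
    by rewrite leq_mul2l max_card orbT.
  have -> : n ^ m.+1 = \sum_(t : {ffun 'I_m -> V}) n.
    by rewrite sum_nat_const card_ffun card_ord expnS mulnC.
  rewrite big_mkcond; apply: leq_sum => t _; rewrite inE -ltnNge.
  by case: ltnP => // /ltnW.
pose Inj := [set g : {ffun 'I_L -> V} | injectiveb g].
pose DD (g : {ffun 'I_L -> V}) := [set t | [forall a, fcons (g a) t \in D]].
have denseG t : t \in T -> n ^ L <= (4 * d) ^ L * #|[set g in Inj | t \in DD g]|.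
  rewrite inE => Tt.
  have -> : #|[set g in Inj | t \in DD g]| = #|N t| ^_ L.
    rewrite -[L in RHS]card_ord -card_inj_ffuns_on; apply: eq_card => g.
    rewrite !inE andbC; congr (_ && _).
    by apply/forallP/ffun_onP => h a; have := h a; rewrite inE.
  (* From [n <= 2 * d * #|N t|] and [4 * d * L <= n] one gets
     [4 * d * (#|N t| - L) >= 2 * n - n]. *)
  apply: leq_trans (_ : (4 * d * (#|N t| - L)) ^ L <= _).
    by case: (L) nL => // L' nL'; rewrite leq_exp2r // mulnBr; lia.
  by rewrite expnMn leq_mul2l leq_exp_ffact orbT.
have [/existsP[g /andP[]]|/existsPn none] := boolP [exists g, (g \in Inj) &&
    (n ^ m <= 2 * d * (4 * d) ^ L * #|DD g|)].
  by rewrite inE => /injectiveP inj_g dg; exists g.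
(* If every injection fails, each weighted count is at most [n ^ m - 1], and summing over the at
   most [n ^ L] injections contradicts [denseT] and [denseG]. *)
exfalso.
suff : n ^ m * n ^ L <= n ^ L * (n ^ m).-1.
  have := expn_gt0 n m; have := expn_gt0 n L; rewrite n0 /=; nia.
apply: leq_trans (_ : \sum_(g in Inj) 2 * d * (4 * d) ^ L * #|DD g| <= _).
  rewrite -big_distrr /=.
  have -> : \sum_(g in Inj) #|DD g| = \sum_t #|[set g in Inj | t \in DD g]|.
    under eq_bigr do rewrite -sum1_card.
    rewrite (exchange_big_dep predT) //=; apply: eq_bigr => t _.
    by rewrite -sum1dep_card.
  apply: leq_trans (_ : 2 * d * #|T| * n ^ L <= _); first by rewrite leq_mul2r denseT orbT.
  rewrite -!mulnA !leq_mul2l; apply/orP; right; apply/orP; right.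
  rewrite -sum_nat_const big_distrr /= [X in _ <= X](bigID (mem T)) /=.
  by apply: leq_trans (leq_addr _ _); apply: leq_sum => t /denseG.
have le_Inj : #|Inj| <= n ^ L.
  by rewrite -[L in n ^ L]card_ord -card_ffun max_card.
apply: leq_trans (leq_mul le_Inj (leqnn _)).
rewrite -sum_nat_const; apply: leq_sum => g gInj.
by have := none g; rewrite gInj /= -ltnNge => lt_n; rewrite -ltnS (ltn_predK lt_n).
Qed.
End DenseBox.

(* The m-partite case of Erdős's theorem on complete multipartite hypergraphs. *)
Lemma dense_box (L m d : nat) : exists n0 : nat,
  forall (V : finType) (D : {set {ffun 'I_m -> V}}),
  n0 <= #|V| -> #|V| ^ m <= d * #|D| ->
  exists2 A : 'I_m -> {set V}, forall i, #|A i| = L &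
    forall f : {ffun 'I_m -> V}, (forall i, f i \in A i) -> f \in D.
Proof.
elim: m d => [|m IHm] d.
  exists 0 => V D _ dD; exists (fun=> set0) => [[]//|f _].
  have /card_gt0P[g gD] : 0 < #|D| by move: dD; rewrite expn0; case: #|D|; rewrite ?muln0.
  by suff -> : f = g by []; apply/ffunP => -[].
have [n0 box] := IHm (2 * d * (4 * d) ^ L).
(* The successor also makes [V] nonempty. *)
exists (maxn n0 (4 * d * L).+1) => V D; rewrite geq_max => /andP[n0V nV] dD.
have [||g inj_g dg] := @dense_box_step V m L d D _ _ dD.
- exact: leq_ltn_trans nV.
- exact: ltnW.
have [A cardA inA] := box _ _ n0V dg.
exists (fun i => oapp A [set g a | a : 'I_L] (unlift ord0 i)) => [i|f fA].
  case: unliftP => [j _|_] /=; first exact: cardA.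
  by rewrite card_imset // card_ord.
have /imsetP[a _ fa] : f ord0 \in [set g a | a : 'I_L].
  by have := fA ord0; rewrite unlift_none.
have : [ffun i => f (lift ord0 i)] \in [set t | [forall a, fcons (g a) t \in D]].
  by apply: inA => i; rewrite ffunE; have := fA (lift ord0 i); rewrite liftK.
by rewrite inE => /forallP/(_ a); rewrite -fa fcons_eta.
Qed.

(** * Cores of expansions in linear hypergraphs *)

Section Shadow.
Variables (n : nat) (EH : {set {set 'I_n}}).

Definition shadow : rel 'I_n :=
  fun u v => (u != v) && [exists e in EH, (u \in e) && (v \in e)].

Lemma shadow_sym : symmetric shadow.
Proof.
move=> u v; rewrite /shadow eq_sym; congr (_ && _).
by apply: eq_existsb => e; rewrite [(u \in e) && _]andbC.
Qed.

Lemma shadow_irr : irreflexive shadow.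
Proof. by move=> u; rewrite /shadow eqxx. Qed.

Hypothesis linH : linear_hg EH.

Lemma linear_edge_eq e1 e2 u v : e1 \in EH -> e2 \in EH -> u != v ->
  u \in e1 -> v \in e1 -> u \in e2 -> v \in e2 -> e1 = e2.
Proof.
move=> e1H e2H uv u1 v1 u2 v2; apply/eqP/negPn/negP => /(linH e1H e2H).
apply/negP; rewrite -ltnNge -[2%N](_ : #|[set u; v]| = _); last by rewrite cards2 uv.
apply: subset_leq_card; apply/fintype.subsetP => w; rewrite !inE.
by case/orP => /eqP ->; rewrite ?u1 ?u2 ?v1 ?v2.
Qed.

End Shadow.

(** * Greedy choice of a core and its completion to an expansion *)

Section Embedding.
Variables (n r : nat) (EH : {set {set 'I_n}}).
Hypotheses (uniH : uniform r EH) (linH : linear_hg EH).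

(** For [a != b], linearity makes the picked edge unique. For [a = b] the choice is arbitrary, which
    is harmless: such sets only enlarge [edge_closure] within its size bound. *)
Definition pair_edge (a b : 'I_n) : {set 'I_n} :=
  odflt set0 [pick e in EH | (a \in e) && (b \in e)].

Lemma pair_edgeE e a b : e \in EH -> a != b -> a \in e -> b \in e -> pair_edge a b = e.
Proof.
move=> eH ab ae be; rewrite /pair_edge; case: pickP => [e' /=|/(_ e)].
  by case/and3P=> e'H ae' be'; apply: (linear_edge_eq linH _ _ ab).
by rewrite /= eH ae be.
Qed.

Lemma card_pair_edge a b : #|pair_edge a b| <= r.
Proof.
rewrite /pair_edge; case: pickP => [e /and3P[/uniH -> _ _] //|_].
by rewrite cards0.
Qed.

Definition edge_closure (W : {set 'I_n}) : {set 'I_n} :=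
  W :|: \bigcup_(a in W) \bigcup_(b in W) pair_edge a b.

Lemma sub_edge_closure (W : {set 'I_n}) a : a \in W -> a \in edge_closure W.
Proof. by move=> aW; rewrite inE aW. Qed.

Lemma mem_edge_closure (W : {set 'I_n}) e a b v : e \in EH -> a != b ->
  a \in W -> b \in W -> a \in e -> b \in e -> v \in e -> v \in edge_closure W.
Proof.
move=> eH ab aW bW ae be ve; rewrite inE; apply/orP; right.
by apply/bigcupP; exists a => //; apply/bigcupP; exists b; rewrite ?(pair_edgeE eH).
Qed.

Lemma card_edge_closure (W : {set 'I_n}) m : #|W| <= m -> #|edge_closure W| <= m + m * (m * r).
Proof.
move=> Wm; apply: leq_trans (_ : #|W| + #|W| * (#|W| * r) <= _); last first.
  by rewrite leq_add // leq_mul // leq_mul.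
rewrite cardsU (leq_trans (leq_subr _ _)) // leq_add2l.
by apply: leq_card_bigcup => a; apply: leq_card_bigcup => b; exact: card_pair_edge.
Qed.

(* Vertices of [S] can serve as the core of an expansion: the edges through two of them
   avoid the other ones and are disjoint from each other outside of [S]. *)
Definition expansion_core (S : {set 'I_n}) : Prop :=
  (forall e a b c, e \in EH -> a \in S -> b \in S -> c \in S -> a != b ->
     a \in e -> b \in e -> c \in e -> c = a \/ c = b) /\
  (forall e e' a b a' b' v, e \in EH -> e' \in EH -> a != b -> a' != b' ->
     a \in S -> b \in S -> a' \in S -> b' \in S -> a \in e -> b \in e ->
     a' \in e' -> b' \in e' -> v \in e -> v \in e' -> v \notin S -> e = e').

Lemma expansion_core0 : expansion_core set0.
Proof. by split=> [e a b c _|e e' a b a' b' v _ _ _ _]; rewrite inE. Qed.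

(** Why the closure is taken twice: an edge through [w] and some [a] in [S] could meet an edge
    spanned by [S] at a vertex [v] outside [S]. Then [v] is in the first closure, so [a] and [v] put
    [w] into the second. *)
Lemma expansion_core_add S w : expansion_core S ->
  w \notin edge_closure (edge_closure S) -> expansion_core (w |: S).
Proof.
move=> [core3 core2] wN.
have H2 e a b : e \in EH -> a != b -> a \in edge_closure S -> b \in edge_closure S ->
    a \in e -> b \in e -> w \notin e.
  move=> eH ab aS bS ae be; apply: contra wN => we.
  exact: mem_edge_closure ae be we.
have H1 e a b : e \in EH -> a != b -> a \in S -> b \in S ->
    a \in e -> b \in e -> w \notin e.
  by move=> eH ab aS bS; apply: H2; rewrite ?sub_edge_closure.
have inS a : a \in w |: S -> a != w -> a \in S by rewrite !inE => /orP[->|].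
(* The critical case: exactly one of two edges meeting outside the core contains [w]. *)
have HX e e' a b a' b' v : e \in EH -> e' \in EH -> a != b -> a' != b' ->
    a \in w |: S -> b \in w |: S -> a' \in w |: S -> b' \in w |: S ->
    a \in e -> b \in e -> a' \in e' -> b' \in e' -> v \in e -> v \in e' ->
    v \notin w |: S -> w \in e -> w \notin e' -> False.
  move=> eH e'H ab ab' aS bS aS' bS' ae be ae' be' ve ve' vN we we'.
  have neq c : c \in e' -> c != w by move=> ce; apply: contraNneq we' => <-.
  have vS : v \in edge_closure S.
    by apply: (mem_edge_closure e'H ab') => //; apply: inS => //; apply: neq.
  have vN' : v \notin S by apply: contra vN; rewrite !inE => ->; rewrite orbT.
  wlog aw : a b ab aS bS ae be / a != w.
    have [aw|aw] := eqVneq a w; last by move/(_ a b); apply.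
    by move/(_ b a); apply => //; rewrite eq_sym // -aw.
  have aS0 := inS _ aS aw.
  have av : a != v by apply: contraNneq vN' => <-.
  by have := H2 _ _ _ eH av (sub_edge_closure aS0) vS ae ve; rewrite we.
split=> [e a b c eH aS bS cS ab ae be ce|].
  have [ca|ca] := eqVneq c a; first by left.
  have [cb|cb] := eqVneq c b; first by right.
  have [aw|aw] := eqVneq a w.
    have := H1 e b c eH; rewrite -aw eq_sym cb ae !inS //;
      first by move=> /(_ isT isT isT be ce).
    - by rewrite -aw.
    - by rewrite -aw eq_sym.
  have [bw|bw] := eqVneq b w.
    have := H1 e a c eH; rewrite -bw eq_sym ca be !inS //;
      first by move=> /(_ isT isT isT ae ce).
    by rewrite -bw.
  have [cw|cw] := eqVneq c w.
    by have := H1 e a b eH ab (inS _ aS aw) (inS _ bS bw) ae be; rewrite -cw ce.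
  by apply: (core3 e) => //; apply: inS.
move=> e e' a b a' b' v eH e'H ab ab' aS bS aS' bS' ae be ae' be' ve ve' vN.
have vw : v != w by apply: contraNneq vN => ->; rewrite !inE eqxx.
have vN' : v \notin S by apply: contra vN; rewrite !inE => ->; rewrite orbT.
have [we|we] := boolP (w \in e); have [we'|we'] := boolP (w \in e').
- exact: (linear_edge_eq linH eH e'H vw).
- by case: (HX e e' a b a' b' v).
- by case: (HX e' e a' b' a b v).
have neq c : c \in e -> c != w by move=> ce; apply: contraNneq we => <-.
have neq' c : c \in e' -> c != w by move=> ce; apply: contraNneq we' => <-.
by apply: (core2 e e' a b a' b' v) => //; apply: inS => //; first [exact: neq|exact: neq'].
Qed.

Definition core_bound p := let u := p + p * (p * r) in u + u * (u * r).

Lemma greedy_expansion_core (P : finType) (C : P -> {set 'I_n}) :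
  (forall x, core_bound #|P| < #|C x|) ->
  exists g : P -> 'I_n, [/\ injective g, forall x, g x \in C x &
    expansion_core [set g x | x : P]].
Proof.
move=> largeC.
have ne x : exists v, v \in C x by apply/card_gt0P; apply: leq_ltn_trans (largeC x).
suff [g [g_inj gC coreg]] : exists g : P -> 'I_n,
    [/\ {in enum P &, injective g}, {in enum P, forall x, g x \in C x} &
        expansion_core [set g x | x in enum P]].
  exists g; split=> [x y|x|].
  - by apply: g_inj; rewrite mem_enum.
  - by apply: gC; rewrite mem_enum.
  suff -> : [set g x | x : P] = [set g x | x in enum P] by [].
  by apply/setP => v; apply/imsetP/imsetP => -[x _ ->]; exists x; rewrite ?mem_enum.
have : uniq (enum P) by rewrite enum_uniq.
elim: (enum P) => [_|t s IHs /= /andP[tNs /IHs[g [g_inj gC coreg]]]].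
  (* A placeholder: only the values on the list treated so far are constrained. *)
  exists (fun x => xchoose (ne x)); split => //.
  suff -> : [set xchoose (ne x) | x in [::]] = set0 by exact: expansion_core0.
  by apply/setP => v; rewrite inE; apply/imsetP => -[].
set S := [set g x | x in s] in coreg.
have cardS : #|S| <= #|P| by apply: leq_trans (leq_imset_card _ _) (max_card _).
have [w wC wN] : exists2 w, w \in C t & w \notin edge_closure (edge_closure S).
  have /subsetPn[w wC wN] : ~~ (C t \subset edge_closure (edge_closure S)).
    apply: contraTN (largeC t) => /subset_leq_card le; rewrite -leqNgt.
    by apply: leq_trans le _; do 2!apply: card_edge_closure.
  by exists w.
have wS : w \notin S by apply: contra wN => wS; do 2!apply: sub_edge_closure.
exists (fun x => if x == t then w else g x); split.
- have gw x : x \in s -> g x != w by move=> xs; apply: contraNneq wS => <-; exact: imset_f.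
  move=> x y; rewrite !inE; case: eqVneq => [->|_] /=; case: eqVneq => [->|_] //= xs ys.
  + by move/esym/eqP; rewrite (negPf (gw _ ys)).
  + by move/eqP; rewrite (negPf (gw _ xs)).
  + exact: g_inj.
- by move=> x; rewrite inE; case: eqVneq => [->//|_] /=; exact: gC.
suff -> : [set if x == t then w else g x | x in t :: s] = w |: S.
  exact: expansion_core_add.
apply/setP => v; rewrite !inE; apply/imsetP/orP.
  case=> x; rewrite inE; case: eqVneq => [_ _ ->|_ /= xs ->]; first by left.
  by right; exact: imset_f.
case=> [/eqP->|/imsetP[x xs ->]]; first by exists t; rewrite ?inE ?eqxx.
exists x; first by rewrite inE xs orbT.
by case: eqVneq xs => // ->; rewrite (negPf tNs).
Qed.

(** Each graph edge [E] goes to a hyperedge [eE E] through the images of its ends, whose other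
    [r - 2] vertices serve as the new ones. The first core property keeps these off the image of
    [g], the second keeps them disjoint for distinct edges. *)
Lemma contains_expansion_of_core (P : finType) (EF : {set {set P}}) (g : P -> 'I_n) (x0 : P) :
  2 <= r -> injective g -> expansion_core [set g x | x : P] ->
  (forall E, E \in EF -> exists x y,
     [/\ x != y, E = [set x; y] & shadow EH (g x) (g y)]) ->
  contains_expansion EH EF r.
Proof.
move=> r2 g_inj [core3 core2] edgeF.
have gS x : g x \in [set g x | x : P] by exact: imset_f.
pose eE (E : {set P}) := odflt set0 [pick e in EH | [forall x in E, g x \in e]].
have eEP E : E \in EF -> eE E \in EH /\ {in E, forall x, g x \in eE E}.
  move=> /edgeF[x [y [_ -> /andP[_ /exists_inP[e eH /andP[xe ye]]]]]].
  rewrite /eE; case: pickP => [e' /= /andP[-> /forall_inP]//|/(_ e) /=].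
  rewrite eH => /forall_inP[] z; rewrite !inE.
  by case/orP => /eqP->.
pose fresh E := eE E :\: g @: E.
have freshN E v : E \in EF -> v \in fresh E -> v \notin [set g x | x : P].
  move=> EEF; have [eH inE'] := eEP _ EEF; have [x [y [xy Exy _]]] := edgeF _ EEF.
  rewrite inE => /andP[vN ve]; apply: contra vN => /imsetP[z _ vz].
  have [xE yE] : x \in E /\ y \in E by rewrite Exy !inE !eqxx orbT.
  rewrite vz in ve *.
  case: (core3 _ (g x) (g y) (g z) eH) => //; rewrite ?inE' ?(inj_eq g_inj) //.
    by move/g_inj->; exact: imset_f.
  by move/g_inj->; exact: imset_f.
have card_fresh E : E \in EF -> #|fresh E| = r - 2.
  move=> EEF; have [eH inE'] := eEP _ EEF; have [x [y [xy Exy _]]] := edgeF _ EEF.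
  rewrite cardsD (uniH eH) (setIidPr _).
    by rewrite card_imset // Exy cards2 xy.
  by apply/fintype.subsetP => v /imsetP[z zE ->]; exact: inE'.
pose f (p : (P + ({set P} * 'I_(r - 2)))%type) : 'I_n :=
  match p with inl x => g x | inr (E, i) => nth (g x0) (enum (fresh E)) i end.
have f_fresh E (i : 'I_(r - 2)) : E \in EF -> f (inr (E, i)) \in fresh E.
  move=> EEF; rewrite /f -[in X in _ \in X](set_enum (fresh E)) inE mem_nth //.
  by rewrite -cardE card_fresh.
have eE_inj E E' : E \in EF -> E' \in EF -> eE E = eE E' -> E = E'.
  move=> EEF EEF'; have [eH inE'] := eEP _ EEF; have [x [y [xy Exy _]]] := edgeF _ EEF.
  have [eH' inE''] := eEP _ EEF'; have [x' [y' [xy' Exy' _]]] := edgeF _ EEF'.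
  have [xE yE] : x \in E /\ y \in E by rewrite Exy !inE !eqxx orbT.
  move=> eq_e; apply/eqP; rewrite eq_sym eqEcard; apply/andP; split; last first.
    by rewrite Exy Exy' !cards2 xy xy'.
  (* An edge through two core vertices contains no third one, so the ends of [E'] are among those of
     [E]. *)
  apply/fintype.subsetP => z /inE''; rewrite -eq_e => ze.
  case: (core3 _ (g x) (g y) (g z) eH) => //; rewrite ?inE' ?(inj_eq g_inj) //.
    by move/g_inj->.
  by move/g_inj->.
have inrV E i : inr (E, i) \in exp_vertices EF r -> E \in EF.
  by rewrite inE => /orP[/imsetP[]//|/imset2P[E' i' EEF' _ [-> _]]].
exists f; split; last first.
  move=> _ /imsetP[E EEF ->]; have [eH inE'] := eEP _ EEF.
  suff -> : f @: exp_edge r E = eE E by [].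
  rewrite imsetU -!imset_comp; apply/setP => v; rewrite inE; apply/orP/idP.
    case=> /imsetP[z zE ->]; first exact: inE'.
    by have := f_fresh E z EEF; rewrite inE => /andP[].
  move=> ve; have [_|vg] := boolP (v \in g @: E); first by left.
  have vf : v \in enum (fresh E) by rewrite mem_enum inE vg.
  right; apply/imsetP.
  have lt_i : index v (enum (fresh E)) < r - 2.
    by rewrite -(card_fresh _ EEF) cardE index_mem.
  by exists (Ordinal lt_i); rewrite //= nth_index.
move=> [x|[E i]] [y|[E' i']] pV qV.
- by move/g_inj->.
- move=> eq; have := freshN _ _ (inrV _ _ qV) (f_fresh E' i' (inrV _ _ qV)).
  by rewrite -eq gS.
- move=> eq; have := freshN _ _ (inrV _ _ pV) (f_fresh E i (inrV _ _ pV)).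
  by rewrite eq gS.
have EEF := inrV _ _ pV; have EEF' := inrV _ _ qV.
move=> eq; have vE := f_fresh E i EEF; have vE' := f_fresh E' i' EEF'.
rewrite -eq in vE'; have vN := freshN _ _ EEF vE.
have EE' : E = E'.
  apply: eE_inj => //.
  have [eH inE'] := eEP _ EEF; have [x [y [xy Exy _]]] := edgeF _ EEF.
  have [eH' inE''] := eEP _ EEF'; have [x' [y' [xy' Exy' _]]] := edgeF _ EEF'.
  have [xE yE] : x \in E /\ y \in E by rewrite Exy !inE !eqxx orbT.
  have [xE' yE'] : x' \in E' /\ y' \in E' by rewrite Exy' !inE !eqxx orbT.
  move: vE vE'; rewrite !inE => /andP[_ ve] /andP[_ ve'].
  apply: (core2 _ _ (g x) (g y) (g x') (g y') _ eH eH' _ _ _ _ _ _ _ _ _ _ ve ve' vN);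
    by rewrite ?inE' ?inE'' ?(inj_eq g_inj).
move: eq; rewrite -EE' /f => /eqP; rewrite nth_uniq ?enum_uniq -?cardE ?card_fresh //.
by move/eqP/val_inj->.
Qed.

End Embedding.

Local Open Scope ring_scope.

(** * A Motzkin--Straus inequality for the signless Laplacian *)

Section QuadraticForms.
Variables (R : realFieldType) (T : finType).
Implicit Types (w a z : T -> R) (A : T -> T -> R).

Lemma sqr_weighted_sum_le w a : (forall i, 0 <= w i) ->
  (\sum_i w i * a i) ^+ 2 <= (\sum_i w i) * (\sum_i w i * a i ^+ 2).
Proof.
move=> w0.
have : 0 <= \sum_i \sum_j w i * w j * (a i - a j) ^+ 2.
  apply: sumr_ge0 => i _; apply: sumr_ge0 => j _.
  by rewrite mulr_ge0 ?sqr_ge0 // mulr_ge0.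
(* Lagrange's identity. *)
suff -> : \sum_i \sum_j w i * w j * (a i - a j) ^+ 2 =
   2 * ((\sum_i w i) * (\sum_i w i * a i ^+ 2)) - 2 * (\sum_i w i * a i) ^+ 2.
  by rewrite -mulrBr pmulr_rge0 // subr_ge0.
have E (p q : T -> R) : (\sum_i p i) * (\sum_i q i) = \sum_i \sum_j p i * q j.
  by rewrite big_distrlr.
rewrite mulr2n mulrDl !mul1r {2}[_ * \sum_i w i * _]mulrC expr2 !E mulr_sumr.
rewrite -big_split -sumrB; apply: eq_bigr => i _ /=.
rewrite mulr_sumr -big_split -sumrB; apply: eq_bigr => j _ /=; ring.
Qed.

Definition quad_form A z := \sum_i \sum_j A i j * z i * z j.
Definition mass_shift (i j : T) : T -> R := fun l => (l == i)%:R - (l == j)%:R.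

Lemma quad_form_mass_shift A i j :
  quad_form A (mass_shift i j) = A i i - A i j - A j i + A j j.
Proof.
have S (f : T -> R) : \sum_l f l * mass_shift i j l = f i - f j.
  have D l0 : \sum_l f l * (l == l0)%:R = f l0.
    rewrite (bigD1 l0) //= eqxx mulr1 big1 ?addr0 // => l /negPf->.
    by rewrite mulr0.
  by under eq_bigr do rewrite mulrBr; rewrite sumrB !D.
rewrite /quad_form; under eq_bigr do rewrite S -mulrBl.
by rewrite S; ring.
Qed.

Lemma quad_form_add A z d t : (forall i j, A i j = A j i) ->
  quad_form A (fun l => z l + t * d l) =
  quad_form A z + 2 * t * (\sum_i \sum_j A i j * z i * d j) + t ^+ 2 * quad_form A d.
Proof.
move=> symA.
set X := \sum_i _.
have E : X = \sum_i \sum_j A i j * d i * z j.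
  rewrite /X exchange_big; apply: eq_bigr => i _; apply: eq_bigr => j _ /=.
  by rewrite symA; ring.
have -> : 2 * t * X = t * X + t * X by ring.
rewrite {2}E /X /quad_form !mulr_sumr -!big_split; apply: eq_bigr => i _ /=.
rewrite !mulr_sumr -!big_split; apply: eq_bigr => j _ /=; ring.
Qed.

(* If two support points [i], [j] are non-adjacent, the form is convex along
   [mass_shift i j], so it is at most its value at one of the two points of this line
   where the support shrinks; this reduces to the case of a clique. *)
Lemma quad_form_le0_of_cliques (e : rel T) A z :
  (forall i j, A i j = A j i) ->
  (forall i j, i != j -> ~~ e i j -> A i j + A j i <= A i i + A j j) ->
  (forall z', (forall i, 0 <= z' i) ->
     (forall i, z' i != 0 -> z i != 0) ->
     (forall i j, z' i != 0 -> z' j != 0 -> i != j -> e i j) -> quad_form A z' <= 0) ->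
  (forall i, 0 <= z i) -> quad_form A z <= 0.
Proof.
move=> symA cvxA.
have [m] := ubnP #|[set i | z i != 0]|; elim: m z => // m IHm z le_m clq z0.
have [[i j] /= /and4P[zi zj neij Neij]|noij] := pickP (fun p : T * T =>
   [&& z p.1 != 0, z p.2 != 0, p.1 != p.2 & ~~ e p.1 p.2]); last first.
  apply: clq => // i j zi zj neij; move: (noij (i, j)) => /=.
  by rewrite zi zj neij /= => /negbFE.
pose d := mass_shift i j.
have zip : 0 < z i by rewrite lt_def zi z0.
have zjp : 0 < z j by rewrite lt_def zj z0.
have di : d i = 1 by rewrite /d /mass_shift eqxx (negPf neij) subr0.
have dj : d j = -1 by rewrite /d /mass_shift eqxx eq_sym (negPf neij) sub0r.
have dl l : l != i -> l != j -> d l = 0.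
  by rewrite /d /mass_shift => /negPf-> /negPf->; rewrite subr0.
have qd : 0 <= quad_form A d.
  rewrite quad_form_mass_shift; move: (cvxA i j neij Neij); lra.
have step t (b : T) : z b != 0 -> z b + t * d b = 0 ->
    (forall l, 0 <= z l + t * d l) -> quad_form A (fun l => z l + t * d l) <= 0.
  move=> zb tb ge0.
  have sub l : z l + t * d l != 0 -> z l != 0.
    apply: contraNneq => zl0.
    have [/eqP|li] := eqVneq l i; first by move=> /eqP li; rewrite -li zl0 eqxx in zi.
    have [lj|lj] := eqVneq l j; first by rewrite -lj zl0 eqxx in zj.
    by rewrite zl0 dl // mulr0 addr0.
  apply: IHm => //.
    rewrite -ltnS; apply: leq_trans le_m; rewrite ltnS.
    apply: proper_card; apply/properP; split.
      by apply/subsetP => l; rewrite !inE; apply: sub.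
    by exists b; rewrite !inE ?zb // tb eqxx.
  by move=> z' z'0 sz; apply: clq => // l /sz/sub.
have ge0 t : - z i <= t -> t <= z j -> forall l, 0 <= z l + t * d l.
  move=> ti tj l; have [->|li] := eqVneq l i; first by rewrite di; lra.
  have [->|lj] := eqVneq l j; first by rewrite dj; lra.
  by rewrite dl // mulr0 addr0.
(* The two ends of the segment of nonnegative weights: [t = z j] kills the weight of [j], and
   [t = - z i] that of [i]. *)
have P1 : quad_form A (fun l => z l + z j * d l) <= 0.
  by apply: (step _ j) => //; [rewrite dj; ring|apply: ge0; lra].
have P2 : quad_form A (fun l => z l + - z i * d l) <= 0.
  by apply: (step _ i) => //; [rewrite di; ring|apply: ge0; lra].
rewrite !quad_form_add // in P1 P2.
move: P1 P2; set B := \sum_i _; set D := quad_form A d; set P := quad_form A z => P1 P2.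
have : (z i + z j) * P <= 0.
  have : 0 <= z i * z j * (z i + z j) * D by rewrite !mulr_ge0 // addr_ge0 // ltW.
  have := mulr_ge0_le0 (ltW zip) P1; have := mulr_ge0_le0 (ltW zjp) P2.
  move=> Q1 Q2 Q3.
  (* Weighting the two ends by [z j] and [z i] cancels the linear term [B]. *)
  have -> : (z i + z j) * P = z j * (P + 2 * - z i * B + (- z i) ^+ 2 * D)
    + z i * (P + 2 * z j * B + z j ^+ 2 * D) - z i * z j * (z i + z j) * D by ring.
  lra.
by rewrite pmulr_rle0 // addr_gt0.
Qed.

Lemma signless_motzkin_straus (k : nat) (e : rel T) (y z : T -> R) :
  (2 <= k)%N -> symmetric e -> irreflexive e -> (forall i, 0 <= z i) ->
  (forall S : {set T}, {in S &, forall i j, i != j -> e i j} -> (#|S| <= k)%N) ->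
  \sum_i \sum_j (e i j)%:R * (y i + y j) ^+ 2 * z i * z j <=
  4 * (1 - k%:R^-1) * (\sum_i z i) * (\sum_i z i * y i ^+ 2).
Proof.
move=> k2 syme irre z0 clq.
have kR : 2 <= k%:R :> R by rewrite ler_nat.
have kV : k%:R * k%:R^-1 = 1 :> R by rewrite divff //; lra.
set c : R := 1 - _.
have EQ (u : T -> R) : 4 * c * (\sum_i u i) * (\sum_i u i * y i ^+ 2) =
    \sum_i \sum_j 2 * c * (y i ^+ 2 + y j ^+ 2) * u i * u j.
  have -> : 4 * c * (\sum_i u i) * (\sum_i u i * y i ^+ 2) =
    2 * c * ((\sum_i u i) * (\sum_i u i * y i ^+ 2) + (\sum_i u i * y i ^+ 2) * (\sum_i u i)).
    ring.
  rewrite !big_distrlr -big_split mulr_sumr; apply: eq_bigr => i _ /=.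
  rewrite -big_split mulr_sumr; apply: eq_bigr => j _ /=; ring.
pose A i j := (e i j)%:R * (y i + y j) ^+ 2 - 2 * c * (y i ^+ 2 + y j ^+ 2).
have EA (u : T -> R) : quad_form A u =
    \sum_i \sum_j (e i j)%:R * (y i + y j) ^+ 2 * u i * u j -
    4 * c * (\sum_i u i) * (\sum_i u i * y i ^+ 2).
  rewrite EQ -sumrB; apply: eq_bigr => i _; rewrite -sumrB.
  by apply: eq_bigr => j _; rewrite /A; ring.
rewrite -subr_le0 -EA; apply: (@quad_form_le0_of_cliques e) => //.
- by move=> i j; rewrite /A syme; ring.
- move=> i j _ Neij; rewrite /A !irre (syme j i) (negPf Neij) !mul0r.
  by rewrite le_eqVlt; apply/orP; left; apply/eqP; ring.
move=> u u0 _ uclq; rewrite EA.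
pose S := [set i | u i != 0].
have cardS : (#|S| <= k)%N by apply: clq => i j; rewrite !inE; apply: uclq.
pose b := \sum_i u i * y i.
have CS1 : b ^+ 2 <= (\sum_i u i) * (\sum_i u i * y i ^+ 2).
  exact: sqr_weighted_sum_le.
pose C := \sum_i (u i * y i) ^+ 2.
have C0 : 0 <= C by apply: sumr_ge0 => i _; apply: sqr_ge0.
(* Cauchy--Schwarz with the indicator of the support, which has at most [k] elements. *)
have CS2 : b ^+ 2 <= k%:R * C.
  have E i : u i * y i = (i \in S)%:R * (u i * y i).
    by rewrite inE; case: eqVneq => [->|_]; rewrite ?mul1r // !mul0r.
  have := @sqr_weighted_sum_le (fun i => (i \in S)%:R) (fun i => u i * y i).
  move=> /(_ (fun i => ler0n _ _)).
  rewrite -(eq_bigr _ (fun i _ => E i)) -/b => /le_trans; apply.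
  have -> : \sum_i (i \in S)%:R = #|S|%:R :> R.
    by rewrite -sum1_card natr_sum [RHS]big_mkcond; apply: eq_bigr => i _; case: (i \in S).
  have -> : \sum_i (i \in S)%:R * (u i * y i) ^+ 2 = C.
    apply: eq_bigr => i _; rewrite inE; case: eqVneq => [->|_].
      by rewrite !mul0r expr0n.
    by rewrite mul1r.
  by rewrite ler_wpM2r // ler_nat.
(* On a clique all off-diagonal pairs count; the missing diagonal accounts for [4 * C]. *)
have -> : \sum_i \sum_j (e i j)%:R * (y i + y j) ^+ 2 * u i * u j =
   2 * ((\sum_i u i) * (\sum_i u i * y i ^+ 2)) + 2 * b ^+ 2 - 4 * C.
  have -> : 2 * ((\sum_i u i) * (\sum_i u i * y i ^+ 2)) + 2 * b ^+ 2 =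
     (\sum_i u i) * (\sum_i u i * y i ^+ 2) +
     (\sum_i u i * y i ^+ 2) * (\sum_i u i) + 2 * (b * b) by ring.
  rewrite /b !big_distrlr /C !mulr_sumr -!big_split -sumrB.
  apply: eq_bigr => i _; rewrite mulr_sumr -!big_split /=.
  rewrite [LHS](bigD1 i) //= [X in X - _](bigD1 i) //= irre mulr0n !mul0r.
  have -> : \sum_(j | j != i) (e i j)%:R * (y i + y j) ^+ 2 * u i * u j =
     \sum_(j | j != i) (u i * (u j * y j ^+ 2) + u i * y i ^+ 2 * u j
        + 2 * (u i * y i * (u j * y j))).
    apply: eq_bigr => j ji; have [->|ui] := eqVneq (u i) 0; first by ring.
    have [->|uj] := eqVneq (u j) 0; first by ring.
    by rewrite uclq // 1?eq_sym // mul1r; ring.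
  by ring.
move: CS1 CS2; set P := (\sum_i u i) * _ => CS1 CS2.
have -> : 4 * c * (\sum_i u i) * (\sum_i u i * y i ^+ 2) = 4 * P - 4 * (k%:R^-1 * P).
  by rewrite /c /P; ring.
have k0 : 0 <= k%:R^-1 :> R by rewrite invr_ge0 ler0n.
(* The goal amounts to [b ^+ 2 - 2 * C <= (1 - 2 / k) * P], which follows from [C >= b ^+ 2 / k] and
   [b ^+ 2 <= P]; the factor is nonnegative as [k >= 2]. *)
have : (1 - 2 * k%:R^-1) * b ^+ 2 <= (1 - 2 * k%:R^-1) * P.
  apply: ler_wpM2l => //.
  by rewrite subr_ge0 -(ler_pM2l (_ : 0 < k%:R)) ?mulr1 1?mulrCA ?kV; lra.
have : k%:R^-1 * b ^+ 2 <= C.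
  by apply: le_trans (ler_wpM2l k0 CS2) _; rewrite mulrA (mulrC _^-1) kV mul1r.
lra.
Qed.
End QuadraticForms.

(** * Sampling *)

Section Sampling.
Variables (R : realFieldType) (V : finType).
Local Notation n := (#|V|%:R : R).

(** Two distinct coordinates of a uniform sample are independent and uniform. Denominators are
    cleared to avoid the exponent [m - 2]. *)
Lemma sum_ffun_eval2 m (i j : 'I_m) (F : V -> V -> R) : i != j ->
  n ^+ 2 * (\sum_(f : {ffun 'I_m -> V}) F (f i) (f j)) =
  n ^+ m * \sum_u \sum_v F u v.
Proof.
move=> ij.
have E (f : {ffun 'I_m -> V}) : F (f i) (f j) =
    \sum_u \sum_v F u v * ((f i == u)%:R * (f j == v)%:R).
  rewrite (bigD1 (f i)) //= (bigD1 (f j)) //= !eqxx !mulr1 big1 ?addr0.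
    rewrite big1 ?addr0 // => u /negPf ui; rewrite big1 // => v _.
    by rewrite eq_sym ui mul0r mulr0.
  by move=> v /negPf vj; rewrite eq_sym vj !mulr0.
rewrite (eq_bigr _ (fun f _ => E f)) exchange_big !mulr_sumr.
apply: eq_bigr => u _ /=; rewrite exchange_big !mulr_sumr.
apply: eq_bigr => v _ /=; rewrite -mulr_sumr mulrCA [RHS]mulrC; congr (_ * _).
pose G (l : 'I_m) (w : V) : R :=
  if l == i then (w == u)%:R else if l == j then (w == v)%:R else 1.
have ji : j != i by rewrite eq_sym.
have EG (f : {ffun 'I_m -> V}) : (f i == u)%:R * (f j == v)%:R = \prod_l G l (f l).
  rewrite (bigD1 i) //= (bigD1 j) //= {1 2}/G !eqxx (negPf ji) big1 ?mulr1 //.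
  by move=> l /andP[/negPf li /negPf lj]; rewrite /G li lj.
rewrite (eq_bigr _ (fun f _ => EG f)) -bigA_distr_bigA.
have G1 (w0 : V) : \sum_w (w == w0)%:R = 1 :> R.
  by rewrite (bigD1 w0) //= eqxx big1 ?addr0 // => w /negPf->.
have -> : n ^+ m = \prod_(l < m) n by rewrite prodr_const card_ord.
rewrite (bigD1 i) // (bigD1 j) //= [RHS](bigD1 i) // [in RHS](bigD1 j) //=.
under eq_bigr do rewrite /G eqxx.
under [X in _ * (_ * (X * _))]eq_bigr do rewrite /G (negPf ji) eqxx.
rewrite !G1 !mul1r expr2 -mulrA; congr (_ * (_ * _)).
apply: eq_bigr => l /andP[/negPf li /negPf lj].
by rewrite /G li lj sumr_const.
Qed.

Lemma sum_ffun_eval m (i : 'I_m) (F : V -> R) :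
  n * (\sum_(f : {ffun 'I_m -> V}) F (f i)) = n ^+ m * \sum_u F u.
Proof.
have E (f : {ffun 'I_m -> V}) : F (f i) = \sum_u F u * (f i == u)%:R.
  rewrite (bigD1 (f i)) //= eqxx mulr1 big1 ?addr0 // => u /negPf ui.
  by rewrite eq_sym ui mulr0.
rewrite (eq_bigr _ (fun f _ => E f)) exchange_big !mulr_sumr.
apply: eq_bigr => u _ /=; rewrite -mulr_sumr mulrCA [RHS]mulrC; congr (_ * _).
pose G (l : 'I_m) (w : V) : R := if l == i then (w == u)%:R else 1.
have EG (f : {ffun 'I_m -> V}) : (f i == u)%:R = \prod_l G l (f l).
  rewrite (bigD1 i) //= {1}/G !eqxx big1 ?mulr1 //.
  by move=> l /negPf li; rewrite /G li.
rewrite (eq_bigr _ (fun f _ => EG f)) -bigA_distr_bigA.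
have -> : n ^+ m = \prod_(l < m) n by rewrite prodr_const card_ord.
rewrite (bigD1 i) //= [RHS](bigD1 i) //=; congr (_ * _).
under eq_bigr do rewrite /G eqxx.
rewrite (bigD1 u) //= eqxx big1 ?addr0 ?mul1r => [|w /negPf->//].
by apply: eq_bigr => l /negPf li; rewrite /G li sumr_const.
Qed.

(* [signless_form e y] is twice the signless Laplacian form of the graph [e]:
   the sum runs over ordered pairs. *)
Definition signless_form (I : finType) (e : rel I) (y : I -> R) : R :=
  \sum_u \sum_v (e u v)%:R * (y u + y v) ^+ 2.

Lemma signless_form_le (I : finType) (e : rel I) y :
  signless_form e y <= 4 * #|I|%:R * \sum_v y v ^+ 2.
Proof.
apply: (@le_trans _ _ (\sum_u \sum_v 2 * (y u ^+ 2 + y v ^+ 2))).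
  apply: ler_sum => u _; apply: ler_sum => v _.
  have : 0 <= (y u - y v) ^+ 2 by rewrite sqr_ge0.
  have : 0 <= (y u + y v) ^+ 2 by rewrite sqr_ge0.
  by case: (e u v) => /=; rewrite ?mul1r ?mul0r; nra.
rewrite le_eqVlt; apply/orP; left; apply/eqP.
have -> : 4 * #|I|%:R * (\sum_v y v ^+ 2) =
  2 * ((\sum_v y v ^+ 2) * (\sum_(v : I) 1) + (\sum_(v : I) 1) * \sum_v y v ^+ 2).
  by rewrite sumr_const; ring.
rewrite !big_distrlr -big_split mulr_sumr; apply: eq_bigr => u _ /=.
by rewrite -big_split mulr_sumr; apply: eq_bigr => v _ /=; ring.
Qed.

(** For [c = 1 - 1/k], a positive value violates [signless_motzkin_straus] for the sampled graph
    with unit weights. *)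
Definition sample_excess m (c : R) (e : rel V) (y : V -> R) (f : {ffun 'I_m -> V}) : R :=
  signless_form (relpre f e) (y \o f) - 4 * c * m%:R * \sum_i y (f i) ^+ 2.

Lemma sum_sample_excess m c (e : rel V) y : irreflexive e ->
  n ^+ 2 * \sum_(f : {ffun 'I_m -> V}) sample_excess c e y f =
  n ^+ m * (m%:R * (m%:R - 1) * signless_form e y
            - 4 * c * m%:R ^+ 2 * n * \sum_v y v ^+ 2).
Proof.
move=> irre; rewrite sumrB mulrBr mulrBr; congr (_ - _).
  rewrite exchange_big mulr_sumr /=.
  rewrite (eq_bigr (fun=> (m%:R - 1) * (n ^+ m * signless_form e y))).
    by rewrite sumr_const card_ord -mulr_natl; ring.
  move=> i _; rewrite exchange_big mulr_sumr (bigD1 i) //= big1.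
    rewrite mulr0 add0r (eq_bigr (fun=> n ^+ m * signless_form e y)).
      rewrite sumr_const -[LHS]mulr_natl; congr (_ * _).
      have := cardC1 i; rewrite card_ord => ->.
      by case: (m) i => [[]//|m' _]; rewrite /= -natr1 addrK.
    move=> j ji.
    by rewrite (sum_ffun_eval2 (fun u v => (e u v)%:R * (y u + y v) ^+ 2)) // eq_sym.
  by move=> f _; rewrite irre mul0r.
rewrite -mulr_sumr exchange_big /= [n ^+ 2 * _]mulrCA mulr_sumr.
rewrite (eq_bigr (fun=> n ^+ m * n * \sum_v y v ^+ 2)).
  by rewrite sumr_const card_ord -mulr_natl; ring.
move=> i _; have /= E := sum_ffun_eval i (fun v => y v ^+ 2).
by rewrite expr2 -[LHS]mulrA E; ring.
Qed.

(** The entries satisfy [y v ^+ 2 <= K / n], so no sample has excess above [4 * m ^ 2 * K / n]; a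
    large average therefore needs many positive samples. *)
Lemma card_positive_samples m c K eps (e : rel V) y :
  irreflexive e -> (0 < #|V|)%N -> (0 < m)%N -> 0 <= c ->
  (forall v, y v ^+ 2 * n <= K) ->
  m%:R * eps * n + signless_form e y + 4 * c * m%:R * n * \sum_v y v ^+ 2
    <= m%:R * signless_form e y ->
  eps * n ^+ m <= 4 * K * #|[set f : {ffun 'I_m -> V} | 0 < sample_excess c e y f]|%:R.
Proof.
move=> irre; rewrite -!(ltr0n R) => n0 m0 c0 yK large.
set P := [set f | _].
have leP (f : {ffun 'I_m -> V}) :
    n * sample_excess c e y f <= 4 * m%:R ^+ 2 * K * (f \in P)%:R.
  rewrite inE; case: ltP => [_|le0] /=; last by rewrite mulr0 pmulr_rle0.
  rewrite mulr1; apply: (@le_trans _ _ (n * signless_form (relpre f e) (y \o f))).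
    rewrite ler_pM2l // lerBlDr lerDl; apply: mulr_ge0.
      by rewrite !mulr_ge0.
    by apply: sumr_ge0 => i _; apply: sqr_ge0.
  apply: le_trans (ler_wpM2l (ltW n0) (signless_form_le _ _)) _.
  have leK : n * \sum_i y (f i) ^+ 2 <= m%:R * K.
    have -> : m%:R * K = \sum_(i < m) K by rewrite sumr_const card_ord mulr_natl.
    by rewrite mulr_sumr; apply: ler_sum => i _; rewrite mulrC.
  rewrite card_ord /=; set S := \sum_i _ in leK *.
  have -> : n * (4 * m%:R * S) = 4 * m%:R * (n * S) by ring.
  have -> : 4 * m%:R ^+ 2 * K = 4 * m%:R * (m%:R * K) by ring.
  by rewrite ler_pM2l // mulr_gt0.
have : \sum_(f : {ffun 'I_m -> V}) n * sample_excess c e y f <= 4 * m%:R ^+ 2 * K * #|P|%:R.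
  apply: le_trans (ler_sum _ (fun f _ => leP f)) _.
  rewrite -mulr_sumr -sum1_card natr_sum [X in _ <= _ * X]big_mkcond.
  rewrite le_eqVlt; apply/orP; left; apply/eqP; congr (_ * _).
  by apply: eq_bigr => f _; case: (f \in P).
rewrite -mulr_sumr => /(ler_wpM2l (ltW n0)).
rewrite mulrA -expr2 sum_sample_excess // => up.
rewrite -(ler_pM2l (_ : 0 < n * m%:R ^+ 2)); last by rewrite mulr_gt0 // exprn_gt0.
have -> : n * m%:R ^+ 2 * (4 * K * #|P|%:R) = n * (4 * m%:R ^+ 2 * K * #|P|%:R) by ring.
apply: le_trans up.
have -> : n * m%:R ^+ 2 * (eps * n ^+ m) = n ^+ m * (m%:R * (m%:R * eps * n)) by ring.
apply: ler_wpM2l; first by rewrite exprn_ge0 // ltW.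
have := ler_wpM2l (ltW m0) large; nra.
Qed.
End Sampling.

(** * Discarding the large entries *)

Section Truncation.
Variables (R : realFieldType) (V : finType).
Local Notation n := (#|V|%:R : R).

Definition truncate (K : R) (y : V -> R) v := if y v ^+ 2 * n <= K then y v else 0.

Lemma truncate_sqr_le K y v : 0 <= K -> truncate K y v ^+ 2 * n <= K.
Proof. by move=> K0; rewrite /truncate; case: ifP => // _; rewrite expr0n mul0r. Qed.

(* The mass [beta] of the discarded entries may contribute about [2 * beta * n] to the
   form; [1 <= 2 * c] makes this at most [4 * c * beta * n], their share of the bound. *)
Lemma signless_form_truncate (K c eps : R) (e : rel V) y :
  (0 < #|V|)%N -> 0 < eps -> 0 < K -> 1 <= 2 * c -> 2 * (1 + 2 / eps) <= eps * K ->
  \sum_v y v ^+ 2 = 1 ->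
  4 * n * (c + eps) <= signless_form e y ->
  2 * eps * n + 4 * c * n * (\sum_v truncate K y v ^+ 2)
    <= signless_form e (truncate K y).
Proof.
rewrite -(ltr0n R) => n0 eps0 K0 c12 KE y1 large.
set y' := truncate K y; pose b v : R := (~~ (y v ^+ 2 * n <= K))%:R.
pose eta := eps / 2; pose B := \sum_v b v; pose beta := \sum_v b v * y v ^+ 2.
have eta0 : 0 < eta by rewrite /eta; lra.
have y'E : \sum_v y' v ^+ 2 = 1 - beta.
  rewrite -y1 -sumrB; apply: eq_bigr => v _; rewrite /y' /truncate /b.
  by case: (_ <= K) => /=; rewrite ?mul0r ?mul1r ?subr0 // expr0n subrr.
have b0 v : 0 <= b v by [].
have beta0 : 0 <= beta by apply: sumr_ge0 => v _; rewrite mulr_ge0 ?sqr_ge0.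
have beta1 : beta <= 1.
  have : 0 <= \sum_v y' v ^+ 2 by apply: sumr_ge0 => v _; exact: sqr_ge0.
  by rewrite y'E subr_ge0.
have BK : B * K <= n * beta.
  rewrite /B /beta mulr_suml mulr_sumr; apply: ler_sum => v _; rewrite /b.
  case: (leP (_ * n)) => /= [_|/ltW]; first by rewrite !mul0r mulr0.
  by rewrite !mul1r mulrC.
(* A bound for [(y u + y v) ^+ 2] when the entry at [u] is discarded. The weight [1 + eta] on that
   entry costs about [n * beta] in total; [1 + eta^-1] on the other costs a multiple of
   [B <= n * beta / K]. *)
pose g u v := (1 + eta) * (b u * y u ^+ 2) + (1 + eta^-1) * (b u * y v ^+ 2).
have amgm (p q : R) : (p + q) ^+ 2 <= (1 + eta) * p ^+ 2 + (1 + eta^-1) * q ^+ 2.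
  have : 0 <= eta^-1 * (eta * p - q) ^+ 2 by rewrite mulr_ge0 ?sqr_ge0 // invr_ge0 ltW.
  have -> : eta^-1 * (eta * p - q) ^+ 2 = eta * p ^+ 2 - 2 * p * q + eta^-1 * q ^+ 2.
    by field; rewrite gt_eqF.
  by nra.
have g0 u v : 0 <= g u v.
  have eV0 : 0 < eta^-1 by rewrite invr_gt0.
  have bs w w' : 0 <= b w * y w' ^+ 2 by rewrite mulr_ge0 ?sqr_ge0.
  by apply: addr_ge0; apply: mulr_ge0 => //; apply: addr_ge0 => //; apply: ltW.
have pw u v : (e u v)%:R * (y u + y v) ^+ 2 <=
    (e u v)%:R * (y' u + y' v) ^+ 2 + (g u v + g v u).
  have := g0 u v; have := g0 v u.
  case: (e u v) => /=; last by rewrite !mul0r; lra.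
  rewrite !mul1r.
  have [bu|bu] := boolP (y u ^+ 2 * n <= K); last first.
    have -> : g u v = (1 + eta) * y u ^+ 2 + (1 + eta^-1) * y v ^+ 2.
      by rewrite /g /b bu !mul1r.
    by have := amgm (y u) (y v); have := sqr_ge0 (y' u + y' v); lra.
  have [bv|bv] := boolP (y v ^+ 2 * n <= K); last first.
    have -> : g v u = (1 + eta) * y v ^+ 2 + (1 + eta^-1) * y u ^+ 2.
      by rewrite /g /b bv !mul1r.
    by have := amgm (y v) (y u); have := sqr_ge0 (y' u + y' v); rewrite (addrC (y v)); lra.
  by rewrite /y' /truncate bu bv; lra.
have sumg : \sum_u \sum_v g u v = (1 + eta) * (n * beta) + (1 + eta^-1) * B.
  have -> : (1 + eta) * (n * beta) + (1 + eta^-1) * B =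
     (1 + eta) * (beta * \sum_(v : V) 1) + (1 + eta^-1) * (B * \sum_v y v ^+ 2).
    by rewrite y1 sumr_const; ring.
  rewrite /beta /B !big_distrlr !mulr_sumr -big_split; apply: eq_bigr => u _ /=.
  rewrite !mulr_sumr -big_split; apply: eq_bigr => v _ /=.
  by rewrite /g mulr1.
have : signless_form e y <= signless_form e y' +
    2 * ((1 + eta) * (n * beta) + (1 + eta^-1) * B).
  rewrite mulr2n mulrDl !mul1r -{1}sumg -sumg [X in _ + (_ + X)]exchange_big /=.
  rewrite /signless_form -!big_split; apply: ler_sum => u _ /=.
  by rewrite -!big_split; apply: ler_sum => v _; exact: pw.
have etaV : eta^-1 = 2 / eps by rewrite /eta invf_div.
have : 2 * (1 + eta^-1) * B <= eps * n.
  rewrite -(ler_pM2r K0) etaV.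
  have : eps * K * B <= eps * n * beta.
    by rewrite -!mulrA ler_pM2l // mulrC.
  have B0 : 0 <= B by apply: sumr_ge0.
  have : eps * n * beta <= eps * n by rewrite ler_piMr // ltW // mulr_gt0.
  move=> h1 h2.
  have := ler_wpM2r (mulr_ge0 B0 (ltW K0)) KE.
  have := ler_wpM2r (ltW K0) (le_trans h2 h1); nra.
have : 2 * eta * (n * beta) <= eps * n.
  have -> : 2 * eta = eps by rewrite /eta; field.
  by rewrite ler_pM2l // ler_piMr // ltW.
rewrite y'E.
have : 0 <= (2 * c - 1) * (n * beta) by rewrite !mulr_ge0 ?subr_ge0 // ltW.
nra.
Qed.
End Truncation.

(* Sampling [m] vertices with repetition: by averaging, a positive proportion of samples
   violates [signless_motzkin_straus], hence contains a [k.+1]-clique on a fixed set [S]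
   of sample indices for a positive proportion of samples. *)
Theorem signless_erdos_stone (R : realType) (k L : nat) (eps : R) :
  (2 <= k)%N -> (0 < L)%N -> 0 < eps ->
  exists n0 : nat, forall (V : finType) (e : rel V) (y : V -> R),
    (n0 <= #|V|)%N -> symmetric e -> irreflexive e -> \sum_v y v ^+ 2 = 1 ->
    4 * #|V|%:R * (1 - k%:R^-1 + eps) <= signless_form e y ->
    exists2 B : 'I_k.+1 -> {set V}, forall a, #|B a| = L &
      forall a b u v, a != b -> u \in B a -> v \in B b -> e u v.
Proof.
move=> k2 L0 eps0.
pose K := 2 * (1 + 2 / eps) / eps.
have K0 : 0 < K by rewrite divr_gt0 // mulr_gt0 // addr_gt0 // divr_gt0.
have KE : 2 * (1 + 2 / eps) <= eps * K by rewrite /K [eps * _]mulrC divfK // gt_eqF.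
pose c : R := 1 - k%:R^-1.
have c12 : 1 <= 2 * c.
  have : k%:R^-1 <= 2^-1 :> R by rewrite lef_pV2 ?posrE ?ltr0n ?ler_nat //; lia.
  by rewrite /c; lra.
(* The form is at most [4 * n <= m * eps * n], which absorbs the loss from pairs of equal
   indices. *)
pose m := (Num.truncn (4 / eps)).+1.
have mE : 4 <= m%:R * eps.
  by rewrite -ler_pdivrMr // ltW // truncnS_gt.
(* A proportion [eps / (4 * K)] of the samples is positive, and pigeonhole over the [2 ^ m] index
   sets costs the other factor. *)
pose d := (Num.truncn ((2 ^ m)%:R * (4 * K / eps))).+1.
have [n0 box] := dense_box L m d.
exists (maxn n0 1) => V e y; rewrite geq_max => /andP[n0V V0] syme irre y1 large.
set n : R := #|V|%:R in large.
have nR0 : 0 < n by rewrite ltr0n.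
pose y' := truncate K y.
have largeT := signless_form_truncate V0 eps0 K0 c12 KE y1 large.
have y'1 : \sum_v y' v ^+ 2 <= 1.
  rewrite -y1; apply: ler_sum => v _; rewrite /y' /truncate.
  by case: ifP => // _; rewrite expr0n sqr_ge0.
set P := [set f : {ffun 'I_m -> V} | 0 < sample_excess c e y' f].
have cardP : eps * n ^+ m <= 4 * K * #|P|%:R.
  apply: card_positive_samples => //; first by lra.
    by move=> v; apply: truncate_sqr_le; exact: ltW.
  have := signless_form_le e y'; rewrite -/y' -/n in largeT *.
  set s := \sum_v _ in y'1 largeT *; set Q := signless_form e y' in largeT *.
  move=> leQ.
  have : Q <= m%:R * eps * n.
    apply: le_trans leQ _; apply: (@le_trans _ _ (4 * n)).
      by rewrite ler_piMr // mulr_ge0 // ltW.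
    by rewrite ler_pM2r.
  have := ler_wpM2l (ler0n R m) largeT; nra.
pose F (S : {set 'I_m}) := [set f : {ffun 'I_m -> V} |
  (k < #|S|)%N && [forall i in S, forall j in S, (i != j) ==> e (f i) (f j)]].
have PF : P \subset \bigcup_(S in setT) F S.
  apply/subsetP => f; rewrite inE => Pf; apply/bigcupP.
  have [/existsP[S FS]|/existsPn noS] := boolP [exists S, f \in F S]; first by exists S.
  suff : sample_excess c e y' f <= 0 by rewrite leNgt Pf.
  have := @signless_motzkin_straus R 'I_m k (relpre f e) (y' \o f) (fun=> 1) k2.
  move=> /(_ (fun i j => syme _ _) (fun i => irre _) (fun=> ler01)).
  rewrite sumr_const card_ord => MS; rewrite subr_le0.
  under eq_bigr do rewrite -[_ ^+ 2]mul1r.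
  apply: le_trans (MS _); last first.
    move=> S clq; rewrite leqNgt; apply/negP => kS.
    case/negP: (noS S); rewrite inE kS /=.
    by apply/forall_inP => i iS; apply/forall_inP => j jS; apply/implyP; exact: clq.
  by apply: ler_sum => i _; apply: ler_sum => j _; rewrite !mulr1.
have [S dS] : exists S, (#|P| <= 2 ^ m * #|F S|)%N.
  have [S _ maxS] := @arg_maxnP _ (set0 : {set 'I_m}) xpredT (fun S => #|F S|) isT.
  exists S; apply: leq_trans (subset_leq_card PF) _.
  rewrite -[m in (2 ^ m)%N]card_ord -cardsT -card_powerset powersetT.
  by apply: leq_card_bigcup => S'; apply: maxS.
have denseF : (#|V| ^ m <= d * #|F S|)%N.
  rewrite -(ler_nat R) natrX natrM -/n.
  rewrite -(ler_pM2l eps0); apply: le_trans cardP _.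
  apply: (@le_trans _ _ (4 * K * ((2 ^ m)%:R * #|F S|%:R))).
    apply: ler_wpM2l; first by rewrite mulr_ge0 // ltW.
    by rewrite -natrM ler_nat.
  have dE : (2 ^ m)%:R * (4 * K) <= eps * d%:R.
    by rewrite -ler_pdivrMl // mulrC -mulrA ltW // truncnS_gt.
  rewrite mulrA [eps * _]mulrA ler_wpM2r //.
  by apply: le_trans dE; rewrite mulrC.
have [A cardA boxA] := box _ _ n0V denseF.
(* The size condition is part of [F S], so any point of the nonempty box yields it. *)
have kS : (k < #|S|)%N.
  have [f0 f0E] : exists f : {ffun 'I_m -> V}, forall i, f i \in A i.
    have ne i : exists v, v \in A i by apply/card_gt0P; rewrite cardA.
    by exists [ffun i => xchoose (ne i)] => i; rewrite ffunE; exact: xchooseP.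
  by have := boxA _ f0E; rewrite inE => /andP[].
pose pick_S (a : 'I_k.+1) := enum_val (widen_ord kS a).
exists (fun a => A (pick_S a)) => [a|a b u v ab ua vb]; first exact: cardA.
have iab : pick_S a != pick_S b.
  by apply: contraNneq ab => /enum_val_inj/(congr1 val) /= /val_inj ->.
have ne i : exists v, v \in A i by apply/card_gt0P; rewrite cardA.
pose f := [ffun i => if i == pick_S a then u else if i == pick_S b then v
                     else xchoose (ne i)].
have fA i : f i \in A i.
  rewrite ffunE; have [->//|_] := eqVneq; have [->//|_] := eqVneq; exact: xchooseP.
have := boxA _ fA; rewrite inE => /andP[_ /forall_inP/(_ _ (enum_valP _))].
move=> /(_ (widen_ord kS a))/forall_inP/(_ _ (enum_valP (widen_ord kS b))).
by rewrite -/(pick_S a) -/(pick_S b) iab !ffunE eqxx eq_sym (negPf iab) eqxx.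
Qed.

(** * From hypergraphs to their shadows *)

(** By linearity each pair of distinct vertices lies in at most one edge, so no shadow pair is
    counted twice. *)
Lemma sum_edge_pairs_le (R : realType) (n : nat) (EH : {set {set 'I_n}})
    (F : 'I_n -> 'I_n -> R) :
  linear_hg EH -> (forall u v, 0 <= F u v) ->
  \sum_(e in EH) \sum_(u in e) \sum_(v in e | v != u) F u v <=
  \sum_u \sum_v (shadow EH u v)%:R * F u v.
Proof.
move=> linH F0.
under eq_bigr do rewrite big_mkcond.
rewrite exchange_big; apply: ler_sum => u _ /=.
have -> : \sum_(e in EH) (if u \in e then \sum_(v in e | v != u) F u v else 0) =
   \sum_(e in EH) \sum_v (if [&& u \in e, v \in e & v != u] then F u v else 0).
  apply: eq_bigr => e _; case: (u \in e) => /=; first by rewrite -big_mkcond.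
  by rewrite big1.
rewrite exchange_big; apply: ler_sum => v _ /=.
rewrite -big_mkcondr /=.
have [->|uv] := eqVneq u v.
  by rewrite big1 ?shadow_irr ?mul0r // => e /and4P[].
have [/exists_inP[e0 e0H /andP[ue0 ve0]]|none] :=
    boolP [exists e in EH, (u \in e) && (v \in e)]; last first.
  rewrite big1 ?mulr_ge0 // => e /and4P[eH ue ve _].
  by case/negP: none; apply/exists_inP; exists e; rewrite ?ue.
have -> : shadow EH u v.
  by rewrite /shadow uv; apply/exists_inP; exists e0; rewrite ?ue0.
rewrite mul1r (bigD1 e0) /= ?e0H ?ue0 ?ve0 1?eq_sym // big1 ?addr0 //.
move=> e /andP[/and4P[eH ue ve _] /eqP ne]; case: ne.
exact: (linear_edge_eq linH eH e0H uv).
Qed.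

Lemma prod_offdiag (R : comNzRingType) (T : finType) (e : {set T}) (y : T -> R) :
  \prod_(u in e) \prod_(v in e | v != u) (y u * y v) =
  (\prod_(u in e) y u) ^+ (2 * #|e|.-1).
Proof.
have E : \prod_(u in e) \prod_(v in e | v != u) y u = (\prod_(u in e) y u) ^+ #|e|.-1.
  rewrite -prodrXl; apply: eq_bigr => u ue; rewrite prodr_const (cardsD1 u e) ue.
  by congr (_ ^+ _); apply: eq_card => v; rewrite !inE andbC.
have E' : \prod_(u in e) \prod_(v in e | v != u) y v = (\prod_(u in e) y u) ^+ #|e|.-1.
  rewrite -E (exchange_big_dep (mem e)) //=; last by move=> u v _ /andP[].
  by apply: eq_bigr => u ue; apply: eq_bigl => v; rewrite ue /= eq_sym.
rewrite mul2n -addnn exprD -{1}E -E' -big_split; apply: eq_bigr => u _ /=.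
by rewrite big_split.
Qed.

(* AM-GM over the ordered pairs of distinct vertices of [e]. *)
Lemma edge_prod_le (R : rcfType) (T : finType) (e : {set T}) (x : T -> R) :
  (1 < #|e|)%N -> (forall v, 0 <= x v) ->
  (#|e|%:R * (#|e|%:R - 1)) * \prod_(v in e) x v <=
  \sum_(u in e) \sum_(v in e | v != u)
     Num.sqrt (x u) ^+ #|e| * Num.sqrt (x v) ^+ #|e|.
Proof.
set r := #|e| => r1 x0; pose y v := Num.sqrt (x v) ^+ r.
have y0 v : 0 <= y v by rewrite exprn_ge0 // sqrtr_ge0.
pose A := [pred p : T * T | [&& p.1 \in e, p.2 \in e & p.2 != p.1]].
have cardA : #|A| = (r * r.-1)%N.
  rewrite -sum1_card.
  rewrite -(pair_big_dep (mem e) (fun u v => (v \in e) && (v != u)) (fun _ _ => 1%N)) /=.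
  rewrite -sum_nat_const; apply: eq_bigr => u ue; rewrite sum1_card /r (cardsD1 u e) ue.
  by apply: eq_card => v; rewrite !inE andbC.
have N0 : (0 < r * r.-1)%N by rewrite muln_gt0; case: (r) r1 => [|[]].
have := (@leif_AGM R _ A (fun p => y p.1 * y p.2)).
move=> /(_ (fun p _ => mulr_ge0 (y0 _) (y0 _)))/leifP/= AGM.
have {AGM} : \prod_(p in A) (y p.1 * y p.2) <=
    ((\sum_(p in A) (y p.1 * y p.2)) / #|A|%:R) ^+ #|A|.
  by move: AGM; case: ifP => _ => [/eqP->|/ltW].
rewrite -(pair_big_dep (mem e) (fun u v => (v \in e) && (v != u)) (fun u v => y u * y v)) /=.
rewrite -(pair_big_dep (mem e) (fun u v => (v \in e) && (v != u)) (fun u v => y u * y v)) /=.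
rewrite prod_offdiag prodrXl -exprM cardA -/r.
(* Both sides of AM-GM become powers with exponent [r * r.-1], which can then be cancelled. *)
have -> : (r * (2 * r.-1) = 2 * (r * r.-1))%N by rewrite mulnCA.
rewrite exprM -prodrXl.
have -> : \prod_(v in e) Num.sqrt (x v) ^+ 2 = \prod_(v in e) x v.
  by apply: eq_bigr => v _; exact: sqr_sqrtr.
rewrite ler_pXn2r ?nnegrE //; first last.
- rewrite divr_ge0 // sumr_ge0 // => u _; rewrite sumr_ge0 // => v _; exact: mulr_ge0.
- by rewrite prodr_ge0.
rewrite ler_pdivlMr ?ltr0n // mulrC natrM.
by rewrite -[r in r%:R - 1](prednK (ltnW r1)) -natr1 addrK.
Qed.

(** With [y v ^+ 2 = |x v| ^+ r], both terms of [qform] split over the edges. Within one edge, the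
    squares [(y u + y v) ^+ 2] over ordered pairs supply the degree part and, by [edge_prod_le], the
    product part. *)
Lemma qform_le_shadow (R : realType) (n r : nat) (EH : {set {set 'I_n}}) (x : 'I_n -> R) :
  (2 <= r)%N -> uniform r EH -> linear_hg EH ->
  2 * (r%:R - 1) * qform r EH x <=
  signless_form (shadow EH) (fun v => Num.sqrt `|x v| ^+ r).
Proof.
move=> r2 uniH linH; set y := fun v => _.
have r1R : 1 <= r%:R - 1 :> R by rewrite lerBrDr (_ : 1 + 1 = 2%:R) // ler_nat.
have y2 v : y v ^+ 2 = `|x v| ^+ r by rewrite /y exprAC sqr_sqrtr.
apply: le_trans (sum_edge_pairs_le linH _); last by move=> u v; exact: sqr_ge0.
have degE : \sum_v (hdeg EH v)%:R * y v ^+ 2 = \sum_(e in EH) \sum_(v in e) y v ^+ 2.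
  rewrite (exchange_big_dep predT) //=; apply: eq_bigr => v _.
  rewrite sumr_const mulr_natl; congr (_ *+ _).
  by apply: eq_card => e; rewrite !inE.
have le1 : qform r EH x <= \sum_v (hdeg EH v)%:R * y v ^+ 2 +
    r%:R * \sum_(e in EH) \prod_(v in e) `|x v|.
  apply: lerD; last first.
    apply: ler_wpM2l => //; apply: ler_sum => e _.
    by rewrite -normr_prod ler_norm.
  apply: ler_sum => v _; rewrite y2; apply: ler_wpM2l => //.
  by rewrite -normrX ler_norm.
apply: le_trans (ler_wpM2l _ le1) _; first by rewrite mulr_ge0 //; lra.
rewrite degE [r%:R * _]mulr_sumr -big_split mulr_sumr; apply: ler_sum => e eH /=.
have er := uniH _ eH.
have := @edge_prod_le R _ e (fun v => `|x v|); rewrite er => /(_ r2 (fun v => normr_ge0 _)).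
set S := \sum_(u in e) _ => leS.
have -> : \sum_(u in e) \sum_(v in e | v != u) (y u + y v) ^+ 2 =
  2 * (r%:R - 1) * (\sum_(u in e) y u ^+ 2) + 2 * S.
  have cst (u : 'I_n) : u \in e -> \sum_(v in e | v != u) y u ^+ 2 = (r%:R - 1) * y u ^+ 2.
    move=> ue; rewrite sumr_const -[LHS]mulr_natl -er (cardsD1 u e) ue -natr1 addrK.
    by congr (_%:R * _); apply: eq_card => v; rewrite !inE andbC.
  have E : \sum_(u in e) \sum_(v in e | v != u) y u ^+ 2 =
      (r%:R - 1) * (\sum_(u in e) y u ^+ 2).
    by rewrite mulr_sumr; apply: eq_bigr => u; exact: cst.
  have E' : \sum_(u in e) \sum_(v in e | v != u) y v ^+ 2 =
      (r%:R - 1) * (\sum_(u in e) y u ^+ 2).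
    rewrite -E (exchange_big_dep (mem e)) //=; last by move=> u v _ /andP[].
    by apply: eq_bigr => u ue; apply: eq_bigl => v; rewrite ue /= eq_sym.
  rewrite mulr2n mulrDl mul1r mulrDl -{1}E -E' mulrDl mul1r -!big_split.
  apply: eq_bigr => u _ /=; rewrite -!big_split; apply: eq_bigr => v _ /=.
  by rewrite -/(y u) -/(y v); ring.
rewrite mulrDr lerD2l -mulrA ler_pM2l // mulrA [_ * r%:R]mulrC.
exact: leS.
Qed.

(** * Assembling the expansion *)

Theorem theorem2p16 (R : realType) (k l r : nat) (eps : R) :
  (2 <= k)%N -> (1 <= l)%N -> (2 <= r)%N ->
  0 < eps -> eps < ((k - 1)%:R)^-1 ->
  exists n0 : nat, forall (n : nat) (EH : {set {set 'I_n}}),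
    (n0 <= n)%N -> uniform r EH -> linear_hg EH ->
    (2 * n%:R / (r - 1)%:R) * (1 - (k%:R)^-1 + eps) <= qH R r EH ->
    contains_expansion EH (complete_multipartite k.+1 l) r.
Proof.
move=> k2 l1 r2 eps0 _.
(* Parts just large enough for the greedy choice of all core vertices. *)
pose L := (core_bound r #|{: 'I_k.+1 * 'I_l}|).+1.
have eps2 : 0 < eps / 2 by rewrite divr_gt0.
have [n0 graph] := signless_erdos_stone k2 (ltn0Sn _ : (0 < L)%N) eps2.
exists (maxn n0 1) => n EH; rewrite geq_max => /andP[n0n n1] uniH linH large.
have nR : 0 < n%:R :> R by rewrite ltr0n.
have rR : 0 < (r - 1)%:R :> R by rewrite ltr0n subn_gt0.
have kV : (k%:R)^-1 <= 1 :> R by rewrite invf_le1 ?ler1n ?ltr0n ?(ltnW k2).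
set M := 2 * n%:R / (r - 1)%:R in large.
have M0 : 0 < M by rewrite divr_gt0 // mulr_gt0.
(* Halving [eps] makes the inequality strict, so some vector exceeds the bound without the supremum
   being attained. *)
have lt_q : M * (1 - k%:R^-1 + eps / 2) < qH R r EH.
  by apply: lt_le_trans large; rewrite ltr_pM2l //; lra.
have [x x1 qx] : exists2 x : 'I_n -> R, \sum_v `|x v| ^+ r = 1 &
    M * (1 - k%:R^-1 + eps / 2) < qform r EH x.
  have q0 : 0 < qH R r EH.
    by apply: le_lt_trans lt_q; rewrite mulr_ge0 ?ltW //; lra.
  (* The supremum of the empty set is [0], so [0 < qH] provides a unit vector. *)
  have [S0|/set0P ne] := eqVneq [set qform r EH x | x in [set x : 'I_n -> R |
      \sum_(v : 'I_n) `|x v| ^+ r = 1]]%classic classical_sets.set0.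
    by move: q0; rewrite /qH S0 sup0 ltxx.
  by have [_ [x x1 <-] ?] := sup_gt ne lt_q; exists x.
pose y v := Num.sqrt `|x v| ^+ r.
have y1 : \sum_v y v ^+ 2 = 1.
  by rewrite -x1; apply: eq_bigr => v _; rewrite /y exprAC sqr_sqrtr.
have [||B cardB adjB] := graph 'I_n (shadow EH) y _ (shadow_sym EH) (shadow_irr EH) y1.
- by rewrite card_ord.
- apply: le_trans (qform_le_shadow x r2 uniH linH).
  rewrite card_ord -(natrB R (ltnW r2)).
  have -> : 4 * n%:R * (1 - k%:R^-1 + eps / 2) =
      2 * (r - 1)%:R * (M * (1 - k%:R^-1 + eps / 2)).
    by rewrite /M; field; rewrite (gt_eqF rR) pnatr_eq0; lia.
  by rewrite ler_pM2l ?mulr_gt0 // ltW.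
have [|g [g_inj gB core]] :=
  @greedy_expansion_core _ _ _ uniH linH ('I_k.+1 * 'I_l)%type (fun p => B p.1).
  by move=> p; rewrite cardB.
apply: (@contains_expansion_of_core _ _ _ uniH _ _ g (ord0, Ordinal l1)) => // E.
case/imset2P => u v _; rewrite inE => uv ->; exists u, v; split => //.
  by apply: contraNneq uv => ->.
by apply: (adjB u.1 v.1) => //; rewrite eq_sym.
Qed.
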